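(* Assume $g$ is $\mu_g$-strongly convex with $\mu_g>0$. Let $\{(x^k,y^k)\}$ be generated by Algorithm 2 (described in the context, with either Option 1 or Option 2) for solving $$F^\star=\min_{(x,y)}\{F(z)=f(x)+g(y)\;:\;Ax+By-c\in\mathcal K\},$$ with $z^k:=(x^k,y^k)$. Let $z^\star=(x^\star,y^\star)\in\mathcal Z^\star$ and $\lambda^\star\in\Lambda^\star$. Then, for all $k\ge1$, $$\big|F(z^k)-F^\star\big|\le\frac{2\max\{\rho_0R_p^2,\;2\|\lambda^\star\|R_d\}}{\rho_0(k+1)^2},\qquad \mathrm{dist}_{\mathcal K}\big(Ax^k+By^k-c\big)\le\frac{4R_d}{\rho_0(k+1)^2},$$ where $R_p^2:=\gamma_0\|x^0-x^\star\|^2+\rho_0\|B\|^2\|y^0-y^\star\|^2$ and $R_d:=\|\lambda^\star\|+\sqrt{\|\lambda^\star\|^2+\rho_0R_p^2}$. Consequently, the convergence rate of Algorithm 2 is $O(1/k^2)$, i.e. $|F(z^k)-F^\star|\le O(1/k^2)$ and $\mathrm{dist}_{\mathcal K}(Ax^k+By^k-c)\le O(1/k^2)$, either in a semi-ergodic sense (Option 1: non-ergodic in $x$ and ergodic in $y$) or in a non-ergodic sense (Option 2).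
   Context: Setting. $f:\mathbb R^{p_1}\to\mathbb R\cup\{+\infty\}$ and $g:\mathbb R^{p_2}\to\mathbb R\cup\{+\infty\}$ are proper, closed, convex; $A\in\mathbb R^{n\times p_1}$, $B\in\mathbb R^{n\times p_2}$ with $B\ne0$, $c\in\mathbb R^n$; $\mathcal K\subseteq\mathbb R^n$ is nonempty, closed, convex. $\|\cdot\|$ is the Euclidean norm for vectors and the induced operator norm for matrices. $g$ is $\mu_g$-strongly convex if $g-\frac{\mu_g}2\|\cdot\|^2$ is convex. $z=(x,y)$, $F(z):=f(x)+g(y)$, $\mathrm{dom}(F)=\mathrm{dom}(f)\times\mathrm{dom}(g)$, and $F^\star$ is the optimal value of minimizing $F(z)$ subject to $Ax+By-c\in\mathcal K$. Lagrange function: $\mathcal L(x,y,r,\lambda):=f(x)+g(y)-\langle Ax+By-r-c,\lambda\rangle$ with $r\in\mathcal K$. A point $(x^\star,y^\star,r^\star,\lambda^\star)\in\mathrm{dom}(f)\times\mathrm{dom}(g)\times\mathcal K\times\mathbb R^n$ is a saddle point if $\mathcal L(x^\star,y^\star,r^\star,\lambda)\le\mathcal L(x^\star,y^\star,r^\star,\lambda^\star)\le\mathcal L(x,y,r,\lambda^\star)$ for all $(x,y)\in\mathrm{dom}(F)$, $r\in\mathcal K$, $\lambda\in\mathbb R^n$. $\mathcal Z^\star$ is the set of $(x^\star,y^\star)$-components and $\Lambda^\star$ the set of $\lambda^\star$-components of saddle points. Standing assumption: the set of saddle points is nonempty, and $F^\star$ is finite and attained at some $(x^\star,y^\star)\in\mathcal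 Z^\star$. $\mathrm{dist}_{\mathcal K}$ and $\mathrm{proj}_{\mathcal K}$ are the Euclidean distance to and projection onto $\mathcal K$. $\psi(x,y):=\frac12\mathrm{dist}_{\mathcal K}(Ax+By-c)^2$, and $\nabla_y\psi(x,y)=B^\top\big(Ax+By-c-\mathrm{proj}_{\mathcal K}(Ax+By-c)\big)$. For $\gamma>0$, $\mathrm{prox}_{\gamma g}(v):=\arg\min_u\{g(u)+\frac1{2\gamma}\|u-v\|^2\}$. Algorithm 2. Choose $(x^0,y^0)\in\mathrm{dom}(F)$, $\rho_0\in\big(0,\frac{\mu_g}{2\|B\|^2}\big]$, $\gamma_0\ge0$; set $\tau_0:=1$, $\hat x^0:=x^0$, $\tilde y^0:=y^0$. For $k=0,1,2,\dots$: - $\tau_{k+1}:=\frac{\tau_k}2\big((\tau_k^2+4)^{1/2}-\tau_k\big)$; - $\hat y^k:=(1-\tau_k)y^k+\tau_k\tilde y^k$; - $x^{k+1}\in\arg\min_x\{f(x)+\rho_k\psi(x,\hat y^k)+\frac{\gamma_0}2\|x-\hat x^k\|^2\}$ (this set is assumed nonempty; any element may be taken); - $\hat x^{k+1}:=x^{k+1}+\frac{\tau_{k+1}(1-\tau_k)}{\tau_k}(x^{k+1}-x^k)$; - $\tilde y^{k+1}:=\mathrm{prox}_{g/(\tau_k\rho_k\|B\|^2)}\big(\tilde y^k-\frac1{\tau_k\|B\|^2}\nabla_y\psi(x^{k+1},\hat y^k)\big)$; - Option 1 (averaging): $y^{k+1}:=(1-\tau_k)y^k+\tau_k\tilde y^{k+1}$;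 or Option 2 (proximal step): $y^{k+1}:=\mathrm{prox}_{g/(\rho_k\|B\|^2)}\big(\hat y^k-\frac1{\|B\|^2}\nabla_y\psi(x^{k+1},\hat y^k)\big)$; - $\rho_{k+1}:=\frac{\rho_k}{1-\tau_{k+1}}$. *)

(* Defs.v *)
From mathcomp Require Export all_boot all_order all_algebra.
From mathcomp Require Export all_classical all_reals all_analysis.
Export Order.TTheory GRing.Theory Num.Theory.
Export numFieldNormedType.Exports.

Set Implicit Arguments.
Unset Strict Implicit.
Unset Printing Implicit Defensive.

Global Open Scope classical_set_scope.
Global Open Scope ring_scope.

Definition dot (R : realType) (n : nat) (u v : 'cV[R]_n) : R :=
  \sum_(i < n) u i 0 * v i 0.

(* Euclidean norm; the library norm `|u| on matrices is the max norm. *)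
Definition enorm (R : realType) (n : nat) (u : 'cV[R]_n) : R :=
  Num.sqrt (dot u u).

Definition opnorm (R : realType) (m n : nat) (B : 'M[R]_(m, n)) : R :=
  sup [set enorm (B *m v) | v in [set v : 'cV[R]_n | enorm v <= 1]].

Definition dist (R : realType) (n : nat) (K : set 'cV[R]_n) (v : 'cV[R]_n) : R :=
  inf [set enorm (v - u) | u in K].

(* The default value 0 is never reached when K is nonempty and closed; the
   projection is unique when K is moreover convex. *)
Definition proj (R : realType) (n : nat) (K : set 'cV[R]_n) (v : 'cV[R]_n) :
    'cV[R]_n :=
  xget 0 [set p | K p /\ forall u, K u -> enorm (v - p) <= enorm (v - u)].

Definition edom (T : Type) (R : realType) (h : T -> \bar R) : set T :=
  [set x | (h x < +oo)%E].

Definition proper_fun (T : Type) (R : realType) (h : T -> \bar R) : Prop :=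
  (forall x, h x != -oo%E) /\ edom h !=set0.

Definition closed_fun (R : realType) (p : nat) (h : 'cV[R]_p -> \bar R) : Prop :=
  closed [set xt : 'cV[R]_p * R | (h xt.1 <= xt.2%:E)%E].

(* Meant for h > -oo only, so that the right-hand side is never oo - oo; recall
   that 0 * +oo = 0. *)
Definition convex_efun (R : realType) (p : nat) (h : 'cV[R]_p -> \bar R) : Prop :=
  forall (x y : 'cV[R]_p) (t : R), 0 <= t -> t <= 1 ->
    (h (t *: x + (1 - t) *: y)%R <= t%:E * h x + (1 - t)%:E * h y)%E.

Definition strongly_convex (R : realType) (p : nat) (mu : R)
    (h : 'cV[R]_p -> \bar R) : Prop :=
  convex_efun (fun u => h u - (mu / 2 * enorm u ^+ 2)%:E)%E.

Definition argmin (T : Type) (R : realType) (h : T -> \bar R) : set T :=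
  [set u | forall v, (h u <= h v)%E].

(* Set-valued; a singleton when g is proper, closed and convex and gamma > 0. *)
Definition prox (R : realType) (p : nat) (gamma : R) (g : 'cV[R]_p -> \bar R)
    (v : 'cV[R]_p) : set 'cV[R]_p :=
  argmin (fun u => g u + (1 / (2 * gamma) * enorm (u - v)%R ^+ 2)%:E)%E.

Definition objective (R : realType) (p1 p2 : nat)
    (f : 'cV[R]_p1 -> \bar R) (g : 'cV[R]_p2 -> \bar R)
    (z : 'cV[R]_p1 * 'cV[R]_p2) : \bar R :=
  (f z.1 + g z.2)%E.

Definition residual (R : realType) (n p1 p2 : nat)
    (A : 'M[R]_(n, p1)) (B : 'M[R]_(n, p2)) (c : 'cV[R]_n)
    (x : 'cV[R]_p1) (y : 'cV[R]_p2) : 'cV[R]_n :=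
  A *m x + B *m y - c.

Definition feasible (R : realType) (n p1 p2 : nat)
    (A : 'M[R]_(n, p1)) (B : 'M[R]_(n, p2)) (c : 'cV[R]_n) (K : set 'cV[R]_n) :
    set ('cV[R]_p1 * 'cV[R]_p2) :=
  [set z | K (residual A B c z.1 z.2)].

Definition optval (R : realType) (n p1 p2 : nat)
    (f : 'cV[R]_p1 -> \bar R) (g : 'cV[R]_p2 -> \bar R)
    (A : 'M[R]_(n, p1)) (B : 'M[R]_(n, p2)) (c : 'cV[R]_n) (K : set 'cV[R]_n) :
    \bar R :=
  ereal_inf [set objective f g z | z in feasible A B c K].

Definition lagrangian (R : realType) (n p1 p2 : nat)
    (f : 'cV[R]_p1 -> \bar R) (g : 'cV[R]_p2 -> \bar R)
    (A : 'M[R]_(n, p1)) (B : 'M[R]_(n, p2)) (c : 'cV[R]_n)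
    (x : 'cV[R]_p1) (y : 'cV[R]_p2) (r lam : 'cV[R]_n) : \bar R :=
  (f x + g y - (dot (A *m x + B *m y - r - c) lam)%:E)%E.

Definition saddle_point (R : realType) (n p1 p2 : nat)
    (f : 'cV[R]_p1 -> \bar R) (g : 'cV[R]_p2 -> \bar R)
    (A : 'M[R]_(n, p1)) (B : 'M[R]_(n, p2)) (c : 'cV[R]_n) (K : set 'cV[R]_n)
    (xs : 'cV[R]_p1) (ys : 'cV[R]_p2) (rs lams : 'cV[R]_n) : Prop :=
  [/\ edom f xs, edom g ys, K rs,
      forall lam, (lagrangian f g A B c xs ys rs lam
                     <= lagrangian f g A B c xs ys rs lams)%E
    & forall x y r, edom f x -> edom g y -> K r ->
        (lagrangian f g A B c xs ys rs lams
           <= lagrangian f g A B c x y r lams)%E].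

Definition primal_solutions (R : realType) (n p1 p2 : nat)
    (f : 'cV[R]_p1 -> \bar R) (g : 'cV[R]_p2 -> \bar R)
    (A : 'M[R]_(n, p1)) (B : 'M[R]_(n, p2)) (c : 'cV[R]_n) (K : set 'cV[R]_n) :
    set ('cV[R]_p1 * 'cV[R]_p2) :=
  [set z | exists r lam, saddle_point f g A B c K z.1 z.2 r lam].

Definition dual_solutions (R : realType) (n p1 p2 : nat)
    (f : 'cV[R]_p1 -> \bar R) (g : 'cV[R]_p2 -> \bar R)
    (A : 'M[R]_(n, p1)) (B : 'M[R]_(n, p2)) (c : 'cV[R]_n) (K : set 'cV[R]_n) :
    set 'cV[R]_n :=
  [set lam | exists x y r, saddle_point f g A B c K x y r lam].

Definition standing_assumption (R : realType) (n p1 p2 : nat)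
    (f : 'cV[R]_p1 -> \bar R) (g : 'cV[R]_p2 -> \bar R)
    (A : 'M[R]_(n, p1)) (B : 'M[R]_(n, p2)) (c : 'cV[R]_n) (K : set 'cV[R]_n) :
    Prop :=
  [/\ exists x y r lam, saddle_point f g A B c K x y r lam,
      optval f g A B c K \is a fin_num
    & exists z, [/\ primal_solutions f g A B c K z, feasible A B c K z
                  & objective f g z = optval f g A B c K]].

Definition psi (R : realType) (n p1 p2 : nat)
    (A : 'M[R]_(n, p1)) (B : 'M[R]_(n, p2)) (c : 'cV[R]_n) (K : set 'cV[R]_n)
    (x : 'cV[R]_p1) (y : 'cV[R]_p2) : R :=
  1 / 2 * dist K (residual A B c x y) ^+ 2.

(* Closed form of the partial gradient of psi in y. *)
Definition grad_y_psi (R : realType) (n p1 p2 : nat)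
    (A : 'M[R]_(n, p1)) (B : 'M[R]_(n, p2)) (c : 'cV[R]_n) (K : set 'cV[R]_n)
    (x : 'cV[R]_p1) (y : 'cV[R]_p2) : 'cV[R]_p2 :=
  let s := residual A B c x y in B^T *m (s - proj K s).

Fixpoint tau (R : realType) (k : nat) : R :=
  if k is k'.+1 then
    tau R k' / 2 * (Num.sqrt (tau R k' ^+ 2 + 4) - tau R k')
  else 1.

Fixpoint rho (R : realType) (rho0 : R) (k : nat) : R :=
  if k is k'.+1 then rho rho0 k' / (1 - tau R k'.+1) else rho0.

Definition yhat (R : realType) (p2 : nat) (y yt : nat -> 'cV[R]_p2) (k : nat) :
    'cV[R]_p2 :=
  (1 - tau R k) *: y k + tau R k *: yt k.

Inductive y_update := Averaging | ProximalStep.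

(* x, y are the iterates, xh is the sequence x-hat and yt is y-tilde.  The same
   y-update option is used at every iteration. *)
Record generated_by (opt : y_update) (R : realType) (n p1 p2 : nat)
    (f : 'cV[R]_p1 -> \bar R) (g : 'cV[R]_p2 -> \bar R)
    (A : 'M[R]_(n, p1)) (B : 'M[R]_(n, p2)) (c : 'cV[R]_n) (K : set 'cV[R]_n)
    (rho0 gamma0 : R) (x xh : nat -> 'cV[R]_p1) (y yt : nat -> 'cV[R]_p2) :
    Prop := GeneratedBy {
  init_x : edom f (x 0%N);
  init_y : edom g (y 0%N);
  init_xh : xh 0%N = x 0%N;
  init_yt : yt 0%N = y 0%N;
  step_x : forall k,
    argmin (fun u => f u + (rho rho0 k * psi A B c K u (yhat y yt k)
                            + gamma0 / 2 * enorm (u - xh k) ^+ 2)%:E)%E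
      (x k.+1);
  step_xh : forall k,
    xh k.+1 = x k.+1
              + (tau R k.+1 * (1 - tau R k) / tau R k) *: (x k.+1 - x k);
  step_yt : forall k,
    prox (1 / (tau R k * rho rho0 k * opnorm B ^+ 2)) g
      (yt k - (1 / (tau R k * opnorm B ^+ 2))
              *: grad_y_psi A B c K (x k.+1) (yhat y yt k))
      (yt k.+1);
  step_y : forall k,
    match opt with
    | Averaging => y k.+1 = (1 - tau R k) *: y k + tau R k *: yt k.+1
    | ProximalStep =>
        prox (1 / (rho rho0 k * opnorm B ^+ 2)) g
          (yhat y yt k - (1 / opnorm B ^+ 2)
                         *: grad_y_psi A B c K (x k.+1) (yhat y yt k))
          (y k.+1)
    end
}.

Definition Rp2 (R : realType) (n p1 p2 : nat) (B : 'M[R]_(n, p2))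
    (rho0 gamma0 : R) (x0 xs : 'cV[R]_p1) (y0 ys : 'cV[R]_p2) : R :=
  gamma0 * enorm (x0 - xs) ^+ 2 + rho0 * opnorm B ^+ 2 * enorm (y0 - ys) ^+ 2.

Definition Rd (R : realType) (n p1 p2 : nat) (B : 'M[R]_(n, p2))
    (rho0 gamma0 : R) (x0 xs : 'cV[R]_p1) (y0 ys : 'cV[R]_p2)
    (lams : 'cV[R]_n) : R :=
  enorm lams
  + Num.sqrt (enorm lams ^+ 2 + rho0 * Rp2 B rho0 gamma0 x0 xs y0 ys).

(* Main.v *)
Require Import Defs.
From mathcomp Require Import ring lra.

Set Implicit Arguments.
Unset Strict Implicit.
Unset Printing Implicit Defensive.

(** The algorithm is an accelerated alternating scheme on the penalized
    objective [F + rho_k psi], with [rho_k = rho_0 / tau_k ^ 2] growing like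
    [k ^ 2].  Write [q = s - proj K s] for the gradient of the half squared
    distance to [K] at the point [s] reached after the x-update.

    One iteration ([penalty_step]).  The optimality conditions of the
    subproblems ([x_update_variational], [prox_variational]), tested at
    [(1 - tau) x_k + tau xs] and at [ys], together with the descent inequality
    for the 1-smooth function [dist K ^ 2 / 2], leave the quantity
    [dist K s ^ 2 / 2 + <q, (1 - tau) s_k + tau s' - s>], where [s_k] and [s']
    are the residuals at [(x_k, y_k)] and [(xs, ys)].  Ordinary convexity bounds
    it by [(1 - tau) dist K s_k ^ 2 / 2], which is too weak, as the penalty
    parameter grows between iterations.  The gradient of [dist K ^ 2 / 2] is
    cocoercive and [s'] lies in [K]; this yields the factor
    [(1 - tau) ^ 2] ([half_sqr_dist_extrapolation]).  As
    [(1 - tau_(k+1)) rho_(k+1) = rho_k], the second factor [1 - tau] exactly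
    undoes the increase of the parameter.

    Telescoping ([penalty_energy_le]).  The increase of the weight of
    [|ytilde_k - ys| ^ 2] is absorbed by the strong convexity of [g]; this is
    where [rho_0 <= mu_g / (2 |B| ^ 2)] enters ([rho_growth]).  The outcome is
    [F(z_(k+1)) + rho_k psi(z_(k+1)) - Fstar <= tau_k ^ 2 Rp2 / 2].

    Conclusion.  Every multiplier gives
    [F(z) - Fstar >= - |lams| dist K (residual z)]
    ([saddle_point_lower_bound]).  With the previous bound this is a quadratic
    inequality in the distance, solved by [quadratic_bound], and
    [tau_k <= 2 / (k + 2)] turns everything into rates. *)

(** * Euclidean geometry *)

Lemma dotC (R : realType) n (u v : 'cV[R]_n) : dot u v = dot v u.
Proof. by apply: eq_bigr => i _; rewrite mulrC. Qed.

Lemma dotDl (R : realType) n (u v w : 'cV[R]_n) :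
  dot (u + v) w = dot u w + dot v w.
Proof. by rewrite /dot -big_split; apply: eq_bigr => i _; rewrite mxE mulrDl. Qed.

Lemma dotZl (R : realType) n a (u w : 'cV[R]_n) : dot (a *: u) w = a * dot u w.
Proof. by rewrite /dot mulr_sumr; apply: eq_bigr => i _; rewrite mxE mulrA. Qed.

Lemma dotNl (R : realType) n (u w : 'cV[R]_n) : dot (- u) w = - dot u w.
Proof. by rewrite -scaleN1r dotZl mulN1r. Qed.

Lemma dot0l (R : realType) n (w : 'cV[R]_n) : dot 0 w = 0.
Proof. by rewrite -(scale0r 0) dotZl mul0r. Qed.

Lemma dotDr (R : realType) n (u v w : 'cV[R]_n) :
  dot w (u + v) = dot w u + dot w v.
Proof. by rewrite dotC dotDl !(dotC w). Qed.

Lemma dotZr (R : realType) n a (u w : 'cV[R]_n) : dot w (a *: u) = a * dot w u.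
Proof. by rewrite dotC dotZl dotC. Qed.

Lemma dotNr (R : realType) n (u w : 'cV[R]_n) : dot w (- u) = - dot w u.
Proof. by rewrite dotC dotNl dotC. Qed.

Definition dotE := (dotDl, dotDr, dotNl, dotNr, dotZl, dotZr).

Lemma dot_trmx (R : realType) m n (B : 'M[R]_(m, n)) u v :
  dot (B^T *m u) v = dot u (B *m v).
Proof.
rewrite /dot; under eq_bigr => j _ do rewrite mxE mulr_suml.
rewrite exchange_big; apply: eq_bigr => i _; rewrite mxE mulr_sumr.
by apply: eq_bigr => j _; rewrite !mxE mulrAC mulrC mulrA.
Qed.

Lemma dot_ge0 (R : realType) n (u : 'cV[R]_n) : 0 <= dot u u.
Proof. by apply: sumr_ge0 => i _; rewrite -expr2 sqr_ge0. Qed.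

Lemma dot_eq0 (R : realType) n (u : 'cV[R]_n) : dot u u = 0 -> u = 0.
Proof.
move/eqP; rewrite psumr_eq0 => [/allP u0|i _]; last by rewrite -expr2 sqr_ge0.
apply/matrixP => i j; rewrite ord1 mxE; apply/eqP.
by have := u0 i (mem_index_enum _); rewrite -expr2 sqrf_eq0.
Qed.

Lemma enorm_ge0 (R : realType) n (u : 'cV[R]_n) : 0 <= enorm u.
Proof. exact: sqrtr_ge0. Qed.

Lemma enorm0 (R : realType) n : enorm (0 : 'cV[R]_n) = 0.
Proof. by rewrite /enorm dot0l sqrtr0. Qed.

Lemma enorm_sqr (R : realType) n (u : 'cV[R]_n) : enorm u ^+ 2 = dot u u.
Proof. by rewrite sqr_sqrtr// dot_ge0. Qed.

Lemma enorm_le (R : realType) n (u v : 'cV[R]_n) :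
  (enorm u <= enorm v) = (dot u u <= dot v v).
Proof. by rewrite ler_sqrt// dot_ge0. Qed.

Lemma enormZ (R : realType) n a (u : 'cV[R]_n) : enorm (a *: u) = `|a| * enorm u.
Proof. by rewrite /enorm dotZl dotZr mulrA -expr2 sqrtrM ?sqr_ge0// sqrtr_sqr. Qed.

Lemma cauchy_schwarz (R : realType) n (u v : 'cV[R]_n) :
  dot u v <= enorm u * enorm v.
Proof.
have [/eqP u0|u_neq0] := eqVneq (enorm u) 0.
  have /dot_eq0 -> : dot u u = 0 by rewrite -enorm_sqr (eqP u0) expr0n.
  by rewrite dot0l mulr_ge0// enorm_ge0.
have [/eqP v0|v_neq0] := eqVneq (enorm v) 0.
  have /dot_eq0 -> : dot v v = 0 by rewrite -enorm_sqr (eqP v0) expr0n.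
  by rewrite dotC dot0l mulr_ge0// enorm_ge0.
have u_gt0 : 0 < enorm u by rewrite lt0r u_neq0 enorm_ge0.
have v_gt0 : 0 < enorm v by rewrite lt0r v_neq0 enorm_ge0.
have := dot_ge0 (enorm v *: u - enorm u *: v).
rewrite !dotE -!enorm_sqr (dotC v u).
have uv_gt0 := mulr_gt0 u_gt0 v_gt0.
move: (enorm u) (enorm v) (dot u v) uv_gt0 => a b d ab h.
by rewrite -(ler_pM2l ab); nra.
Qed.

Lemma sqr_coord_le_dot (R : realType) n (u : 'cV[R]_n) i : u i 0 ^+ 2 <= dot u u.
Proof.
rewrite /dot (bigD1 i)//= -expr2 lerDl.
by apply: sumr_ge0 => j _; rewrite -expr2 sqr_ge0.
Qed.

(** * The operator norm *)

(** The Frobenius norm bounds the set, by Cauchy-Schwarz on each row. *)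
Lemma opnorm_has_sup (R : realType) m n (B : 'M[R]_(m, n)) :
  has_sup [set enorm (B *m v) | v in [set v : 'cV[R]_n | enorm v <= 1]].
Proof.
split.
  exists (enorm (B *m 0)), 0 => //=.
  by rewrite enorm0.
pose M := \sum_(i < m) enorm (row i B)^T ^+ 2.
have M0 : 0 <= M by apply: sumr_ge0 => i _; rewrite sqr_ge0.
exists (Num.sqrt M) => _ [v /= v1 <-].
rewrite ler_sqrt//; apply: ler_sum => i _; rewrite -expr2.
have -> : (B *m v) i 0 = dot (row i B)^T v.
  by rewrite mxE; apply: eq_bigr => j _; rewrite !mxE.
have bv (w : 'cV[R]_n) : dot (row i B)^T w <= enorm (row i B)^T * enorm w.
  exact: cauchy_schwarz.
have bvv : `|dot (row i B)^T v| <= enorm (row i B)^T.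
  apply: (@le_trans _ _ (enorm (row i B)^T * enorm v)); last first.
    by rewrite ler_piMr// enorm_ge0.
  rewrite ler_norml bv andbT lerNl -dotNr (le_trans (bv _))//.
  by rewrite -scaleN1r enormZ normrN1 mul1r.
by rewrite -real_normK ?num_real// ler_pXn2r// nnegrE enorm_ge0.
Qed.

Lemma enorm_mulmx_le (R : realType) m n (B : 'M[R]_(m, n)) v :
  enorm (B *m v) <= opnorm B * enorm v.
Proof.
have [v0|v_neq0] := eqVneq (enorm v) 0.
  have -> : v = 0 by apply: dot_eq0; rewrite -enorm_sqr v0 expr0n.
  by rewrite mulmx0 !enorm0 mulr0.
have v_gt0 : 0 < enorm v by rewrite lt0r v_neq0 enorm_ge0.
rewrite -ler_pdivrMr// mulrC -(ger0_norm (ltW v_gt0)) -normfV -enormZ.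
rewrite scalemxAr; apply: ub_le_sup; first by case: (opnorm_has_sup B).
exists ((enorm v)^-1 *: v) => //=.
by rewrite enormZ normfV (ger0_norm (ltW v_gt0)) mulVf.
Qed.

Lemma dot_mulmx_le (R : realType) m n (B : 'M[R]_(m, n)) v :
  dot (B *m v) (B *m v) <= opnorm B ^+ 2 * dot v v.
Proof.
rewrite -!enorm_sqr -exprMn ler_pXn2r ?nnegrE ?enorm_ge0//.
  exact: enorm_mulmx_le.
exact: le_trans (enorm_ge0 _) (enorm_mulmx_le _ _).
Qed.

Lemma opnorm_gt0 (R : realType) m n (B : 'M[R]_(m, n)) : B != 0 -> 0 < opnorm B.
Proof.
rewrite ltNge; apply: contra => B_le0; apply/eqP/matrixP => i j; rewrite mxE.
have /dot_eq0 /matrixP/(_ i 0) : dot (B *m delta_mx j 0) (B *m delta_mx j 0) = 0.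
  apply/eqP; rewrite -enorm_sqr sqrf_eq0 eq_le enorm_ge0 andbT.
  apply: le_trans (enorm_mulmx_le _ _) _.
  by rewrite mulr_le0_ge0// enorm_ge0.
by rewrite -colE !mxE.
Qed.

(** * Projection onto a closed convex set *)

Lemma trmx_continuous (R : realType) m n :
  continuous (@trmx R m n).
Proof.
move=> w; have wF := @nbhs_filter _ w.
have twF : Filter (nbhs (trmx @ w)) := fmap_filter _ wF.
apply/cvg_ballP => e e0.
apply: (filterS _ (nbhsx_ballx w e e0)) => w' [_ ww']; split=> // i j.
by rewrite !mxE; exact: ww'.
Qed.

Lemma enorm_rV_continuous (R : realType) n (v : 'cV[R]_n) :
  continuous (fun w : 'rV[R]_n => enorm (v - w^T)).
Proof.
move=> w; have wF := @nbhs_filter _ w.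
apply: (@continuous_comp _ _ _
  (fun w : 'rV[R]_n => dot (v - w^T) (v - w^T)) (@Num.sqrt R)); last first.
  exact: sqrt_continuous.
rewrite /dot; apply: cvg_big => [|i _]; first exact: add_continuous.
have ci : (fun x : 'rV[R]_n => (v - x^T) i 0) @ w --> (v - w^T) i 0.
  under eq_fun do rewrite !mxE; rewrite !mxE; apply: cvgB; first exact: cvg_cst.
  exact: coord_continuous.
exact: cvgM.
Qed.

(** Compactness of bounded closed sets is stated for row vectors, so the set of
    competitors that are at least as good as one fixed point of [K] is
    transposed before the extreme value theorem applies. *)
Lemma closest_point_exists (R : realType) n (K : set 'cV[R]_n) (v : 'cV[R]_n) :
  K !=set0 -> closed K ->
  exists p, K p /\ forall u, K u -> enorm (v - p) <= enorm (v - u).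
Proof.
move=> [k0 Kk0] Kcl.
pose S := [set w : 'rV[R]_n | K w^T /\ enorm (v - w^T) <= enorm (v - k0)].
have S0 : S !=set0 by exists k0^T => /=; rewrite /S /= trmxK.
have Scl : closed S.
  apply: (@closedI _ (trmx @^-1` K)
    ((fun w => enorm (v - w^T)) @^-1` [set r | r <= enorm (v - k0)])).
    by apply: preimage_closed => // w _; exact: trmx_continuous.
  apply: preimage_closed; last exact: closed_le.
  by move=> w _; exact: enorm_rV_continuous.
have Sbd : bounded_set S.
  exists (\sum_(i < n) `|v i 0| + enorm (v - k0)); split; first exact: num_real.
  move=> M ltM w [_ wS]; rewrite /= [leLHS]/Num.norm /= mx_normrE.
  apply: bigmax_le => [|[i j] _ /=].
    apply: le_trans (ltW ltM).
    by rewrite addr_ge0 ?enorm_ge0// sumr_ge0.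
  rewrite ord1; apply: le_trans (ltW ltM).
  have -> : w 0 j = v j 0 - (v - w^T) j 0 by rewrite !mxE opprB addrC subrK.
  apply: (le_trans (ler_normB _ _)); apply: lerD.
    by rewrite (bigD1 j)//= lerDl sumr_ge0.
  apply: le_trans wS; rewrite -sqrtr_sqr ler_sqrt ?dot_ge0//.
  exact: sqr_coord_le_dot.
have [p pS pmin] := compact_EVT_min S0 (bounded_closed_compact Sbd Scl)
  (continuous_subspaceT (@enorm_rV_continuous R n v)).
move: pS; rewrite inE => -[Kp pk0].
exists p^T; split=> // u Ku.
have [uk0|/ltW k0u] := leP (enorm (v - u)) (enorm (v - k0)).
  have := pmin u^T; rewrite trmxK; apply; rewrite inE.
  by rewrite /S /= trmxK.
exact: le_trans pk0 k0u.
Qed.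

Lemma proj_closest (R : realType) n (K : set 'cV[R]_n) (v : 'cV[R]_n) :
  K !=set0 -> closed K ->
  K (proj K v) /\ forall u, K u -> enorm (v - proj K v) <= enorm (v - u).
Proof.
by move=> K0 Kcl; apply: (@xgetPex _ 0) (closest_point_exists v K0 Kcl).
Qed.

Lemma dist_proj (R : realType) n (K : set 'cV[R]_n) (v : 'cV[R]_n) :
  K !=set0 -> closed K -> dist K v = enorm (v - proj K v).
Proof.
move=> K0 Kcl; have [Kp pmin] := proj_closest v K0 Kcl.
apply/eqP; rewrite eq_le; apply/andP; split.
  apply: ge_inf; last by exists (proj K v).
  by exists 0 => _ [u _ <-]; exact: enorm_ge0.
apply: lb_le_inf; first by exists (enorm (v - proj K v)), (proj K v).
by move=> _ [u Ku <-]; exact: pmin.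
Qed.

(** Passage to the limit at 0, in the form in which every variational
    inequality below is derived from a minimality property. *)
Lemma ge0_of_affine_ge0 (R : realFieldType) (a b : R) :
  (forall t, 0 < t -> t <= 1 -> 0 <= a + t * b) -> 0 <= a.
Proof.
move=> ab; rewrite leNgt; apply/negP => a_lt0.
have [b_le0|b_gt0] := lerP b 0.
  by have := ab 1 ltr01 (lexx _); lra.
(* A point of the unit interval lying before the root [- a / b]. *)
have t_gt0 : 0 < - a / (b - a) by rewrite divr_gt0 ?oppr_gt0// subr_gt0; lra.
have := ab _ t_gt0; rewrite ler_pdivrMr ?mul1r; last by lra.
move=> /(_ ltac:(lra)).
have -> : a + - a / (b - a) * b = - a * a / (b - a).
  by field; rewrite subr_eq0 gt_eqF//; lra.
by rewrite pmulr_lge0 ?invr_gt0; nra.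
Qed.

Lemma proj_variational (R : realType) n (K : set 'cV[R]_n) (v u : 'cV[R]_n) :
  K !=set0 -> closed K -> convex_set (K : set (convex_lmodType 'cV[R]_n)) ->
  K u -> dot (v - proj K v) (u - proj K v) <= 0.
Proof.
move=> K0 Kcl Kcvx Ku; have [Kp pmin] := proj_closest v K0 Kcl.
move: (proj K v) Kp pmin => p Kp pmin.
rewrite -oppr_ge0.
apply: (@ge0_of_affine_ge0 _ _ (dot (u - p) (u - p) / 2)) => t t0 t1.
have Kt : K (p + t *: (u - p)).
  have -> : p + t *: (u - p) = t *: u + (1 - t) *: p.
    by rewrite scalerBl scale1r scalerBr addrCA.
  have := Kcvx u p (Itv01 (ltW t0) t1); rewrite !inE => /(_ Ku Kp).
  exact.
have := pmin _ Kt; rewrite enorm_le opprD addrA.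
move: (v - p) (u - p) => q d.
rewrite !dotE (dotC d q).
by nra.
Qed.

Lemma dist_ge0 (R : realType) n (K : set 'cV[R]_n) (v : 'cV[R]_n) :
  K !=set0 -> closed K -> 0 <= dist K v.
Proof. by move=> K0 Kcl; rewrite dist_proj// enorm_ge0. Qed.

(** The projection of [v] is a competitor for the distance from [w] to [K], and
    the square expands exactly. *)
Lemma half_sqr_dist_smooth (R : realType) n (K : set 'cV[R]_n) (v w : 'cV[R]_n) :
  K !=set0 -> closed K ->
  1 / 2 * dist K w ^+ 2
  <= 1 / 2 * dist K v ^+ 2 + dot (v - proj K v) (w - v)
     + 1 / 2 * dot (w - v) (w - v).
Proof.
move=> K0 Kcl; rewrite !dist_proj// !enorm_sqr.
have [Kp _] := proj_closest v K0 Kcl.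
have [_ /(_ _ Kp)] := proj_closest w K0 Kcl; rewrite enorm_le.
have -> : w - proj K v = (w - v) + (v - proj K v) by rewrite addrA subrK.
move: (w - v) (v - proj K v) (w - proj K w) => d q r.
by rewrite !dotE (dotC q d); lra.
Qed.

(** The last term of the left-hand side is what the cocoercivity of the
    gradient [v - proj K v] adds to plain convexity; it comes from the
    variational inequality at [proj K v] tested with [proj K w]. *)
Lemma half_sqr_dist_convex (R : realType) n (K : set 'cV[R]_n) (v w : 'cV[R]_n) :
  K !=set0 -> closed K -> convex_set (K : set (convex_lmodType 'cV[R]_n)) ->
  1 / 2 * dist K v ^+ 2 + dot (v - proj K v) (w - v)
  + 1 / 2 * dot (w - proj K w - (v - proj K v)) (w - proj K w - (v - proj K v))
  <= 1 / 2 * dist K w ^+ 2.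
Proof.
move=> K0 Kcl Kcvx; rewrite !dist_proj// !enorm_sqr.
have [Kp _] := proj_closest w K0 Kcl.
have := proj_variational v K0 Kcl Kcvx Kp.
have -> : w - v = (w - proj K w) - (v - proj K v) + (proj K w - proj K v).
  by apply/matrixP => i j; rewrite !mxE; ring.
move: (v - proj K v) (w - proj K w) (proj K w - proj K v) => q r d.
by rewrite !dotE (dotC r q); lra.
Qed.

Lemma proj_id (R : realType) n (K : set 'cV[R]_n) (v : 'cV[R]_n) :
  K !=set0 -> closed K -> K v -> proj K v = v.
Proof.
move=> K0 Kcl Kv; have [_ /(_ _ Kv)] := proj_closest v K0 Kcl.
rewrite subrr enorm0 => dle.
apply/esym/eqP; rewrite -subr_eq0; apply/eqP/dot_eq0.
apply/eqP; rewrite -enorm_sqr sqrf_eq0 eq_le dle.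
exact: enorm_ge0.
Qed.

(** Writing [q] and [r] for the gradients at [v] and [w], the two cocoercive
    bounds weighted by [t] and [1 - t] leave the defect
    [t |q| ^ 2 / 2 + (1 - t) |r - q| ^ 2 / 2], whose minimum over [q] is
    [t (1 - t) |r| ^ 2 / 2]: this is the gap between [1 - t] and
    [(1 - t) ^ 2]. *)
Lemma half_sqr_dist_extrapolation (R : realType) n (K : set 'cV[R]_n)
    (v w s : 'cV[R]_n) t :
  K !=set0 -> closed K -> convex_set (K : set (convex_lmodType 'cV[R]_n)) ->
  K s -> 0 <= t -> t <= 1 ->
  1 / 2 * dist K v ^+ 2 + dot (v - proj K v) ((1 - t) *: w + t *: s - v)
  <= (1 - t) ^+ 2 * (1 / 2 * dist K w ^+ 2).
Proof.
move=> K0 Kcl Kcvx Ks t0 t1.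
have := half_sqr_dist_convex v s K0 Kcl Kcvx.
have := half_sqr_dist_convex v w K0 Kcl Kcvx.
rewrite !dist_proj// (proj_id K0 Kcl Ks) subrr enorm0 sub0r.
have -> : (1 - t) *: w + t *: s - v = (1 - t) *: (w - v) + t *: (s - v).
  by apply/matrixP => i j; rewrite !mxE; ring.
have := dot_ge0 (t *: (w - proj K w) - (w - proj K w - (v - proj K v))).
rewrite !enorm_sqr.
move: (v - proj K v) (w - proj K w) (w - v) (s - v) => q r d e.
rewrite !dotE (dotC r q) => sq hw hs.
have t1' : 0 <= 1 - t by rewrite subr_ge0.
have := ler_wpM2l t0 hs; have := ler_wpM2l t1' hw.
by lra.
Qed.

(** * The parameter sequences *)

Lemma tau_bounds (R : realType) k : 0 < tau R k /\ tau R k <= 1.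
Proof.
elim: k => [|k [t_gt0 t_le1]] /=; first by rewrite ltr01.
move: (tau R k) t_gt0 t_le1 => t t_gt0 t_le1.
have s_ge0 := sqrtr_ge0 (t ^+ 2 + 4).
have s2 : Num.sqrt (t ^+ 2 + 4) ^+ 2 = t ^+ 2 + 4.
  by rewrite sqr_sqrtr// addr_ge0// sqr_ge0.
move: (Num.sqrt _) s_ge0 s2 => s s_ge0 s2.
have ts : t < s by nra.
have s_le : s <= t + 2 by nra.
by split; nra.
Qed.

Lemma tau_gt0 (R : realType) k : 0 < tau R k.
Proof. by case: (tau_bounds R k). Qed.

Lemma tau_le1 (R : realType) k : tau R k <= 1.
Proof. by case: (tau_bounds R k). Qed.

Lemma tauS_sqr (R : realType) k :
  tau R k.+1 ^+ 2 = (1 - tau R k.+1) * tau R k ^+ 2.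
Proof.
rewrite /=; move: (tau R k) => t.
have s2 : Num.sqrt (t ^+ 2 + 4) ^+ 2 = t ^+ 2 + 4.
  by rewrite sqr_sqrtr// addr_ge0// sqr_ge0.
move: (Num.sqrt _) s2 => s s2.
have -> : (t / 2 * (s - t)) ^+ 2 = t ^+ 2 / 4 * (s ^+ 2 - 2 * s * t + t ^+ 2).
  by field.
by rewrite s2; field.
Qed.

Lemma tauS_lt1 (R : realType) k : tau R k.+1 < 1.
Proof.
have := tauS_sqr R k; have := tau_gt0 R k; have := tau_gt0 R k.+1.
by move: (tau R k) (tau R k.+1) => t t' t_gt0 t'_gt0 e; nra.
Qed.

(** The defining quadratic equation of the sequence, in terms of the inverses;
    it gives both [invtauS_le] and the linear growth [invtau_ge]. *)
Lemma invtauS (R : realType) k :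
  (tau R k.+1)^-1 ^+ 2 = (tau R k)^-1 ^+ 2 + (tau R k.+1)^-1.
Proof.
have := tauS_sqr R k; have := tau_gt0 R k; have := tau_gt0 R k.+1.
move: (tau R k) (tau R k.+1) => t t' t_gt0 t'_gt0 e.
have t_neq0 := lt0r_neq0 t_gt0; have t'_neq0 := lt0r_neq0 t'_gt0.
apply: (mulIf (mulf_neq0 (expf_neq0 2 t'_neq0) (expf_neq0 2 t_neq0))).
rewrite [RHS](_ : _ = t' ^+ 2 + t' * t ^+ 2); last by field; rewrite ?t_neq0.
rewrite [LHS](_ : _ = t ^+ 2); last by field; rewrite ?t_neq0.
by rewrite e; ring.
Qed.

Lemma invtauS_le (R : realType) k : (tau R k.+1)^-1 <= (tau R k)^-1 + 1.
Proof.
have := invtauS R k.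
have : 0 < (tau R k)^-1 by rewrite invr_gt0 tau_gt0.
have : 0 < (tau R k.+1)^-1 by rewrite invr_gt0 tau_gt0.
by move: (tau R k)^-1 (tau R k.+1)^-1 => a b b0 a0 e; nra.
Qed.

Lemma invtau_ge (R : realType) k : (k%:R + 2) / 2 <= (tau R k)^-1.
Proof.
elim: k => [|k IHk]; first by rewrite /= invr1 add0r divff.
have := invtauS R k.
have : 0 < (tau R k)^-1 by rewrite invr_gt0 tau_gt0.
have : 0 < (tau R k.+1)^-1 by rewrite invr_gt0 tau_gt0.
rewrite -natr1; move: IHk; move: (tau R k)^-1 (tau R k.+1)^-1 => a b ka b0 a0 e.
have b1 : 1 < b by nra.
have ab : a + 1 / 2 <= b.
  have h : 0 < a + b - 1 / 2 by lra.
  by rewrite -subr_ge0 -(pmulr_rge0 _ h); nra.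
by lra.
Qed.

Lemma rho_tau (R : realType) (rho0 : R) k : rho rho0 k * tau R k ^+ 2 = rho0.
Proof.
elim: k => [|k IHk]; first by rewrite /= expr1n mulr1.
rewrite tauS_sqr -{2}IHk [rho _ k.+1]/= -/(tau R k.+1) mulrA divfK//.
by rewrite lt0r_neq0// subr_gt0; exact: (tauS_lt1 R k).
Qed.

Lemma rhoE (R : realType) (rho0 : R) k : rho rho0 k = rho0 * (tau R k)^-1 ^+ 2.
Proof.
by rewrite -{2}(rho_tau rho0 k) exprVn mulfK// expf_neq0// lt0r_neq0// tau_gt0.
Qed.

(** With [rho_k = rho_0 / tau_k ^ 2] the two penalty parameters differ by
    [rho_0 / tau_(k+1)], and [tau_k <= 2 tau_(k+1)]. *)
Lemma rho_growth (R : realType) (rho0 L mu : R) k :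
  0 < rho0 -> 0 < L -> rho0 <= mu / (2 * L) ->
  rho rho0 k.+1 * L * tau R k ^+ 2 <= rho rho0 k * L * tau R k ^+ 2 + tau R k * mu.
Proof.
move=> rho0_gt0 L_gt0; rewrite ler_pdivlMr ?mulr_gt0// => mu_ge.
rewrite !rhoE invtauS.
have := invtauS_le R k; have := tau_gt0 R k; have := tau_le1 R k.
move: (tau R k) (tau R k.+1)^-1 => t b t1 t0 b_le.
have t_neq0 : t != 0 by rewrite gt_eqF.
have -> : rho0 * (t^-1 ^+ 2 + b) * L * t ^+ 2 = rho0 * L + rho0 * L * (b * t * t).
  by field.
have -> : rho0 * t^-1 ^+ 2 * L * t ^+ 2 = rho0 * L by field.
have bt : b * t <= 2.
  apply: (@le_trans _ _ ((t^-1 + 1) * t)); first by rewrite ler_pM2r.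
  by rewrite mulrDl mulVf// mul1r; lra.
have := ler_wpM2r (ltW t0) bt.
have rL := mulr_gt0 rho0_gt0 L_gt0.
move=> /(ler_wpM2l (ltW rL)); nra.
Qed.

(** * Convex functions and minimality on the effective domain *)

Lemma edom_fineK (T : Type) (R : realType) (h : T -> \bar R) x :
  (forall u, h u != -oo%E) -> edom h x -> (fine (h x))%:E = h x.
Proof. by move=> hN; rewrite /edom /=; case: (h x) (hN x). Qed.

Lemma convex_strongly0 (R : realType) p (h : 'cV[R]_p -> \bar R) :
  convex_efun h -> strongly_convex 0 h.
Proof.
rewrite /strongly_convex (_ : (fun u => _) = h)//.
by apply/funext => u; rewrite mul0r mul0r sube0.
Qed.

(** On the effective domain everything is finite, and the quadratic term moves
    to the right-hand side through the parallelogram-type identity for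
    [t |x| ^ 2 + (1 - t) |y| ^ 2]. *)
Lemma strongly_convex_fine (R : realType) p mu (h : 'cV[R]_p -> \bar R) x y t :
  (forall u, h u != -oo%E) -> strongly_convex mu h ->
  edom h x -> edom h y -> 0 <= t -> t <= 1 ->
  edom h (t *: x + (1 - t) *: y) /\
  fine (h (t *: x + (1 - t) *: y)) <=
    t * fine (h x) + (1 - t) * fine (h y)
    - mu / 2 * (t * (1 - t)) * dot (x - y) (x - y).
Proof.
move=> hN hcvx hx hy t0 t1.
have := hcvx x y t t0 t1; rewrite /= -(edom_fineK hN hx) -(edom_fineK hN hy).
rewrite !enorm_sqr.
have := hN (t *: x + (1 - t) *: y); rewrite /edom /=.
case: (h (t *: x + (1 - t) *: y)) => [r||]// _.
rewrite -!EFinB -!EFinM -EFinD lee_fin /= => le_r; split; first exact: ltry.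
apply: le_trans (_ : r - mu / 2 * dot (t *: x + (1 - t) *: y) (t *: x + (1 - t) *: y)
  + mu / 2 * dot (t *: x + (1 - t) *: y) (t *: x + (1 - t) *: y) <= _).
  by rewrite subrK.
rewrite -lerBrDr; apply: le_trans le_r _.
by rewrite !dotE (dotC y x) le_eqVlt; apply/orP; left; apply/eqP; ring.
Qed.

Lemma argmin_fine (T : Type) (R : realType) (h : T -> \bar R) (phi : T -> R) p u :
  (forall u, h u != -oo%E) -> edom h u ->
  argmin (fun u => h u + (phi u)%:E)%E p ->
  edom h p /\ fine (h p) + phi p <= fine (h u) + phi u.
Proof.
move=> hN hu /(_ u) /=; rewrite -(edom_fineK hN hu) /edom /=.
by case: (h p) (hN p) => [r||]// _; rewrite -!EFinD lee_fin ltry.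
Qed.

(** A first-order optimality condition without derivatives or subgradients: on
    the segment from the minimizer [m] to [u], an upper quadratic model of
    [phi] with slope [a] is enough, since its curvature [b] disappears in the
    limit. *)
Lemma argmin_first_order (R : realType) p mu (h : 'cV[R]_p -> \bar R)
    (phi : 'cV[R]_p -> R) (m u : 'cV[R]_p) (a b : R) :
  (forall u, h u != -oo%E) -> strongly_convex mu h ->
  argmin (fun u => h u + (phi u)%:E)%E m -> edom h u ->
  (forall t, 0 < t -> t <= 1 ->
     phi (t *: u + (1 - t) *: m) <= phi m + t * a + t ^+ 2 * b) ->
  fine (h m) <= fine (h u) + a - mu / 2 * dot (u - m) (u - m).
Proof.
move=> hN hcvx hm hu phi_le.
have [dm _] := argmin_fine hN hu hm.
rewrite -subr_ge0.
apply: (@ge0_of_affine_ge0 _ _ (mu / 2 * dot (u - m) (u - m) + b)) => t t0 t1.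
have [dt ht] := strongly_convex_fine hN hcvx hu dm (ltW t0) t1.
have [_] := argmin_fine hN dt hm.
have := phi_le t t0 t1; rewrite -(pmulr_rge0 _ t0).
move: (fine _) (phi _) ht => r1 r2.
by move: (fine _) (fine _) (phi _) (dot _ _) => r3 r4 r5 r6; nra.
Qed.

(** * Optimality conditions of the subproblems *)

Lemma prox_variational (R : realType) p mu gam (g : 'cV[R]_p -> \bar R)
    (v m u : 'cV[R]_p) :
  (forall u, g u != -oo%E) -> strongly_convex mu g ->
  prox gam g v m -> edom g u ->
  fine (g m) <= fine (g u) + gam^-1 * dot (m - v) (u - m)
                - mu / 2 * dot (u - m) (u - m).
Proof.
move=> gN gcvx gm gu.
apply: (argmin_first_order (b := gam^-1 / 2 * dot (u - m) (u - m)) gN gcvx gm gu).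
move=> t t0 t1.
have -> : t *: u + (1 - t) *: m - v = (m - v) + t *: (u - m).
  by apply/matrixP => i j; rewrite !mxE; ring.
rewrite !enorm_sqr invfM; move: (m - v) (u - m) => w d.
by rewrite !dotE (dotC d w); move: gam^-1 => h; lra.
Qed.

Lemma x_update_variational (R : realType) n p1 p2 (f : 'cV[R]_p1 -> \bar R)
    (A : 'M[R]_(n, p1)) (B : 'M[R]_(n, p2)) c (K : set 'cV[R]_n)
    r gam (xh : 'cV[R]_p1) (yh : 'cV[R]_p2) (m u : 'cV[R]_p1) :
  (forall u, f u != -oo%E) -> convex_efun f -> K !=set0 -> closed K -> 0 <= r ->
  argmin (fun u => f u + (r * psi A B c K u yh
                          + gam / 2 * enorm (u - xh) ^+ 2)%:E)%E m ->
  edom f u ->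
  forall s, s = residual A B c m yh ->
  fine (f m) <= fine (f u) + r * dot (s - proj K s) (A *m (u - m))
                + gam * dot (m - xh) (u - m).
Proof.
move=> fN fcvx K0 Kcl r0 fm fu s sE.
rewrite -addrA.
set a := (X in _ <= _ + X).
pose b := r / 2 * dot (A *m (u - m)) (A *m (u - m))
          + gam / 2 * dot (u - m) (u - m).
have := argmin_first_order (a := a) (b := b) fN (convex_strongly0 fcvx) fm fu.
rewrite mul0r mul0r subr0; apply => t t0 t1.
have := half_sqr_dist_smooth s (residual A B c (t *: u + (1 - t) *: m) yh) K0 Kcl.
rewrite /psi -sE.
have -> : residual A B c (t *: u + (1 - t) *: m) yh - s = t *: (A *m (u - m)).
  rewrite sE /residual mulmxDr mulmxBr -!scalemxAr.
  by apply/matrixP => i j; rewrite !mxE; ring.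
have -> : t *: u + (1 - t) *: m - xh = (m - xh) + t *: (u - m).
  by apply/matrixP => i j; rewrite !mxE; ring.
rewrite !enorm_sqr /a /b; move: (A *m (u - m)) (s - proj K s) (m - xh)
  (u - m) => w q d e.
rewrite !dotE (dotC e d) => /(ler_wpM2l r0).
by move: (dist _ _) (dist _ _) => d1 d2; lra.
Qed.

(** Both options satisfy the same inequality.  It is an equality up to convexity
    of [g] for the averaged point, and the proximal point does at least as well
    because the averaged point is a competitor in its subproblem. *)
Lemma y_update_variational (R : realType) p (g : 'cV[R]_p -> \bar R) opt
    (t r L : R) (G yk yh ytk yp ytp : 'cV[R]_p) :
  (forall u, g u != -oo%E) -> convex_efun g -> 0 <= t -> t <= 1 ->
  0 < r -> 0 < L -> edom g yk -> edom g ytp ->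
  yh = (1 - t) *: yk + t *: ytk ->
  match opt with
  | Averaging => yp = (1 - t) *: yk + t *: ytp
  | ProximalStep => prox (1 / (r * L)) g (yh - (1 / L) *: G) yp
  end ->
  edom g yp /\
  fine (g yp) + r * dot G (yp - yh) + r * L / 2 * dot (yp - yh) (yp - yh)
  <= (1 - t) * fine (g yk) + t * fine (g ytp)
     + t * r * dot G (ytp - ytk)
     + r * L * t ^+ 2 / 2 * dot (ytp - ytk) (ytp - ytk).
Proof.
move=> gN gcvx t0 t1 r0 L0 gyk gytp yhE.
have [gu] := strongly_convex_fine gN (convex_strongly0 gcvx) gytp gyk t0 t1.
set u := (_ + _) in gu *; rewrite !mul0r subr0 => gu_le.
have uE : u - yh = t *: (ytp - ytk).
  by rewrite yhE; apply/matrixP => i j; rewrite !mxE; ring.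
have uE' : dot G (u - yh) = t * dot G (ytp - ytk) by rewrite uE dotZr.
have uE2 : dot (u - yh) (u - yh) = t ^+ 2 * dot (ytp - ytk) (ytp - ytk).
  by rewrite uE dotZr dotZl mulrA.
case: opt => [ypE|ypP].
  have -> : yp = u by rewrite ypE addrC.
  by split=> //; rewrite uE' uE2; lra.
have [gyp _] := argmin_fine gN gu ypP; split=> //.
have := prox_variational gN (convex_strongly0 gcvx) ypP gu.
rewrite !mul0r subr0 div1r invrK.
have -> : u - yp = (u - yh) - (yp - yh) by rewrite opprB addrA subrK.
have -> : yp - (yh - (1 / L) *: G) = (yp - yh) + L^-1 *: G.
  by rewrite div1r opprB addrCA addrC.
have rLK : r * L * L^-1 = r by rewrite mulfK// gt_eqF.
have := dot_ge0 ((u - yh) - (yp - yh)).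
have -> : t * r * dot G (ytp - ytk) = r * dot G (u - yh) by rewrite uE'; ring.
have -> : r * L * t ^+ 2 / 2 * dot (ytp - ytk) (ytp - ytk)
          = r * L / 2 * dot (u - yh) (u - yh) by rewrite uE2; ring.
move: (u - yh) (yp - yh) => d e; rewrite !dotE (dotC e d).
have rGd := congr1 ( *%R^~ (dot G d)) rLK.
have rGe := congr1 ( *%R^~ (dot G e)) rLK.
move: L^-1 rGd rGe {rLK} => i /= rGd rGe sq.
have := mulr_ge0 (mulr_ge0 (ltW r0) (ltW L0)) sq.
by lra.
Qed.

(** The auxiliary point [xk + t^-1 *: (xp - xk)] is the extrapolation that turns
    the momentum form of the x-update into the same averaging pattern as the
    y-update: [xp] is then [(1 - t) *: xk] plus [t] times that point. *)
Lemma penalty_step (R : realType) n p1 p2 (opt : y_update)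
    (f : 'cV[R]_p1 -> \bar R) (g : 'cV[R]_p2 -> \bar R)
    (A : 'M[R]_(n, p1)) (B : 'M[R]_(n, p2)) c (K : set 'cV[R]_n)
    (mu gam t r : R) (xk xtk xh xp xs : 'cV[R]_p1)
    (yk ytk yh ytp yp ys : 'cV[R]_p2) :
  let L := opnorm B ^+ 2 in
  let G := grad_y_psi A B c K xp yh in
  (forall u, f u != -oo%E) -> convex_efun f ->
  (forall u, g u != -oo%E) -> convex_efun g -> strongly_convex mu g ->
  B != 0 -> K !=set0 -> closed K ->
  convex_set (K : set (convex_lmodType 'cV[R]_n)) ->
  0 < t -> t <= 1 -> 0 < r -> 0 <= gam ->
  edom f xk -> edom f xs -> edom g yk -> edom g ys -> K (residual A B c xs ys) ->
  xh = (1 - t) *: xk + t *: xtk -> yh = (1 - t) *: yk + t *: ytk ->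
  argmin (fun u => f u + (r * psi A B c K u yh
                          + gam / 2 * enorm (u - xh) ^+ 2)%:E)%E xp ->
  prox (1 / (t * r * L)) g (ytk - (1 / (t * L)) *: G) ytp ->
  match opt with
  | Averaging => yp = (1 - t) *: yk + t *: ytp
  | ProximalStep => prox (1 / (r * L)) g (yh - (1 / L) *: G) yp
  end ->
  [/\ edom f xp, edom g yp &
   fine (f xp) + fine (g yp) + r * psi A B c K xp yp
   + t ^+ 2 * (gam / 2 * enorm (xk + t^-1 *: (xp - xk) - xs) ^+ 2)
   + (r * L * t ^+ 2 + t * mu) / 2 * enorm (ytp - ys) ^+ 2
   <= (1 - t) * (fine (f xk) + fine (g yk)) + t * (fine (f xs) + fine (g ys))
      + (1 - t) ^+ 2 * (r * psi A B c K xk yk)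
      + t ^+ 2 * (gam / 2 * enorm (xtk - xs) ^+ 2)
      + r * L * t ^+ 2 / 2 * enorm (ytk - ys) ^+ 2].
Proof.
move=> L G fN fcvx gN gcvx gscvx B0 K0 Kcl Kcvx t0 t1 r0 gam0 fxk fxs gyk gys Ks
  xhE yhE xpP ytpP ypP.
have L0 : 0 < L by rewrite exprn_gt0// opnorm_gt0.
have t_neq0 : t != 0 by rewrite gt_eqF.
have [fxp _] := argmin_fine fN fxk xpP.
have [gytp _] := argmin_fine gN gyk ytpP.
have [gyp yp_le] := y_update_variational gN gcvx (ltW t0) t1 r0 L0 gyk gytp yhE ypP.
split=> //.
set s := residual A B c xp yh.
set q := s - proj K s.
have GE v : dot G v = dot q (B *m v) by rewrite /G /grad_y_psi dot_trmx.
have [fxb fxb_le] := strongly_convex_fine fN (convex_strongly0 fcvx) fxs fxk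
  (ltW t0) t1.
have := x_update_variational fN fcvx K0 Kcl (ltW r0) xpP fxb (erefl s).
rewrite -/q; set xb := (_ + _) in fxb fxb_le * => xp_le.
rewrite !mul0r subr0 in fxb_le.
set xtp := xk + _.
(* Both [xp] and [xh] are averages giving the weight [1 - t] to [xk], as [xb]
   does, so their distances to [xb] scale by [t]. *)
have xpE : xp - xb = t *: (xtp - xs).
  rewrite /xtp /xb scalerBr scalerDr scalerA divff// scale1r.
  by apply/matrixP => i j; rewrite !mxE; ring.
have xhbE : xh - xb = t *: (xtk - xs).
  by rewrite xhE; apply/matrixP => i j; rewrite !mxE; ring.
have gamE : dot (xp - xh) (xb - xp) <=
    t ^+ 2 / 2 * dot (xtk - xs) (xtk - xs) - t ^+ 2 / 2 * dot (xtp - xs) (xtp - xs).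
  have -> : xp - xh = (xp - xb) - (xh - xb) by rewrite opprB addrA subrK.
  have -> : xb - xp = - (xp - xb) by rewrite opprB.
  rewrite xpE xhbE; move: (xtp - xs) (xtk - xs) => d e.
  have := mulr_ge0 (sqr_ge0 t) (dot_ge0 (d - e)).
  by rewrite !dotE (dotC e d); lra.
(* The y-terms are expressed through [a] and [b], with [ys - ytk = a + b], so
   that the three-point identity is a plain expansion. *)
have := prox_variational gN gscvx ytpP gys.
set a := ytp - ytk; set b := ys - ytp.
have -> : ytp - (ytk - (1 / (t * L)) *: G) = a + (t * L)^-1 *: G.
  by rewrite div1r opprB addrCA addrC.
rewrite div1r invrK dotDl dotZl GE mulrDr [_ * (_^-1 * _)]mulrA.
have -> : t * r * L / (t * L) = r by field; rewrite t_neq0 gt_eqF.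
move=> /(ler_wpM2l (ltW t0)) ytp_le.
rewrite !GE -/a in yp_le.
have := half_sqr_dist_smooth s (residual A B c xp yp) K0 Kcl.
have -> : residual A B c xp yp - s = B *m (yp - yh).
  by rewrite /s /residual mulmxBr; apply/matrixP => i j; rewrite !mxE; ring.
rewrite -/q => psi_le.
have {}psi_le := le_trans psi_le (lerD (lexx _) (ler_wpM2l _ (dot_mulmx_le _ _))).
have := half_sqr_dist_extrapolation s (residual A B c xk yk) K0 Kcl Kcvx Ks
  (ltW t0) t1.
have -> : (1 - t) *: residual A B c xk yk + t *: residual A B c xs ys - s
          = A *m (xb - xp) + t *: (B *m (a + b)).
  rewrite /s /xb yhE /a /b /residual !mulmxDr !mulmxN -!scalemxAr.
  by apply/matrixP => i j; rewrite !mxE; ring.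
rewrite -/q => /(ler_wpM2l (ltW r0)) ex_le.
have {}psi_le := ler_wpM2l (ltW r0) (psi_le ltac:(lra)).
have {}gamE := ler_wpM2l gam0 gamE.
rewrite /psi !enorm_sqr.
have -> : ytk - ys = - (a + b) by apply/matrixP => i j; rewrite !mxE; ring.
have -> : ytp - ys = - b by rewrite opprB.
clearbody a b q.
move: psi_le ex_le ytp_le yp_le gamE xp_le; rewrite -/L (mulmxDr B a b).
move: (dot (yp - yh) _) (dot (xtp - xs) _) (dot (xtk - xs) _) (dot (xp - xh) _).
move: (B *m (yp - yh)) (A *m (xb - xp)) (B *m a) (B *m b)
  => v1 v2 v3 v4 e1 e2 e3 e4.
rewrite !dotE (dotC b a).
move: (dist _ _) (dist _ _) (dist _ _) => d1 d2 d3.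
by lra.
Qed.

(** * Saddle points *)

(** The Lagrangian is affine in the multiplier, so it is bounded above only if
    its slope vanishes. *)
Lemma saddle_point_residual (R : realType) n p1 p2
    (f : 'cV[R]_p1 -> \bar R) (g : 'cV[R]_p2 -> \bar R)
    (A : 'M[R]_(n, p1)) (B : 'M[R]_(n, p2)) c (K : set 'cV[R]_n) xs ys rs lams :
  (forall u, f u != -oo%E) -> (forall u, g u != -oo%E) ->
  saddle_point f g A B c K xs ys rs lams -> residual A B c xs ys = rs.
Proof.
move=> fN gN [fxs gys _ maxlam _].
set d := A *m xs + B *m ys - rs - c.
have := maxlam (lams - d); rewrite /lagrangian -/d.
rewrite -(edom_fineK fN fxs) -(edom_fineK gN gys) -!EFinD lee_fin.
rewrite [dot d (lams - d)]dotDr dotNr => dd.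
have /dot_eq0 d0 : dot d d = 0 by apply/eqP; rewrite eq_le dot_ge0 andbT; lra.
by apply/eqP; rewrite -subr_eq0 -d0 /d /residual addrAC.
Qed.

(** The saddle inequality is used with [r] the projection of the residual onto
    [K], which makes the multiplier term as small as Cauchy-Schwarz permits. *)
Lemma saddle_point_lower_bound (R : realType) n p1 p2
    (f : 'cV[R]_p1 -> \bar R) (g : 'cV[R]_p2 -> \bar R)
    (A : 'M[R]_(n, p1)) (B : 'M[R]_(n, p2)) c (K : set 'cV[R]_n) xs ys rs lams x y :
  (forall u, f u != -oo%E) -> (forall u, g u != -oo%E) -> K !=set0 -> closed K ->
  saddle_point f g A B c K xs ys rs lams -> edom f x -> edom g y ->
  fine (f xs) + fine (g ys)
  <= fine (f x) + fine (g y) + enorm lams * dist K (residual A B c x y).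
Proof.
move=> fN gN K0 Kcl sp fx gy.
have rsE := saddle_point_residual fN gN sp.
have [fxs gys _ _ minz] := sp.
have [Kp _] := proj_closest (residual A B c x y) K0 Kcl.
have := minz _ _ _ fx gy Kp.
rewrite /lagrangian -(edom_fineK fN fxs) -(edom_fineK gN gys).
rewrite -(edom_fineK fN fx) -(edom_fineK gN gy) -!EFinD lee_fin /=.
rewrite (_ : A *m xs + B *m ys - rs - c = 0); last first.
  by rewrite -rsE; apply/matrixP => i j; rewrite !mxE; ring.
rewrite dot0l subr0 => h; apply: (le_trans h); rewrite lerD2l.
rewrite dist_proj// mulrC -dotNr.
rewrite (_ : enorm lams = enorm (- lams)); last first.
  by rewrite -scaleN1r enormZ normrN1 mul1r.
rewrite addrAC; exact: cauchy_schwarz.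
Qed.

Lemma saddle_point_optval (R : realType) n p1 p2
    (f : 'cV[R]_p1 -> \bar R) (g : 'cV[R]_p2 -> \bar R)
    (A : 'M[R]_(n, p1)) (B : 'M[R]_(n, p2)) c (K : set 'cV[R]_n) xs ys rs lams :
  (forall u, f u != -oo%E) -> (forall u, g u != -oo%E) -> K !=set0 -> closed K ->
  saddle_point f g A B c K xs ys rs lams ->
  optval f g A B c K = (fine (f xs) + fine (g ys))%:E.
Proof.
move=> fN gN K0 Kcl sp.
have rsE := saddle_point_residual fN gN sp.
have [fxs gys Krs _ _] := sp.
apply/eqP; rewrite eq_le; apply/andP; split.
  apply: ereal_inf_lbound; exists (xs, ys); first by rewrite /feasible /= rsE.
  by rewrite /objective /= EFinD !edom_fineK.
apply: le_ereal_inf_tmp => _ [[x y] /= Kr <-]; rewrite /objective /=.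
have [fx|] := ltP (f x) +oo%E; last first.
  by rewrite leye_eq => /eqP ->; rewrite addye ?leey// gN.
have [gy|] := ltP (g y) +oo%E; last first.
  by rewrite leye_eq => /eqP ->; rewrite addey ?leey// fN.
rewrite -(edom_fineK fN fx) -(edom_fineK gN gy) -EFinD lee_fin.
have := saddle_point_lower_bound fN gN K0 Kcl sp fx gy.
by rewrite dist_proj// proj_id// subrr enorm0 mulr0 addr0.
Qed.

(** * The energy estimate *)

(** The sequence that the momentum step hides: it is to [x] what y-tilde is to
    the averaged [y]; see [xhat_xtilde]. *)
Definition xtilde (R : realType) p (x : nat -> 'cV[R]_p) (k : nat) : 'cV[R]_p :=
  if k is k'.+1 then x k' + (tau R k')^-1 *: (x k - x k') else x 0%N.

Lemma xhat_xtilde (R : realType) p (x xh : nat -> 'cV[R]_p) k :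
  xh 0%N = x 0%N ->
  (forall k, xh k.+1 = x k.+1
     + (tau R k.+1 * (1 - tau R k) / tau R k) *: (x k.+1 - x k)) ->
  xh k = (1 - tau R k) *: x k + tau R k *: xtilde x k.
Proof.
move=> xh0 xhS; case: k => [|k]; first by rewrite xh0 subrr scale0r add0r scale1r.
rewrite xhS /xtilde; have := tau_gt0 R k.
move: (tau R k) (tau R k.+1) => t t' /lt0r_neq0 t_neq0.
by apply/matrixP => i j; rewrite !mxE; field.
Qed.

(** The first step has [tau_0 = 1], so the coefficient [1 - tau_0] erases the
    initial objective value and the bound depends on the initial point only
    through [Rp2].  At later steps the coefficient
    [1 - tau_(k+1) = tau_(k+1) ^ 2 / tau_k ^ 2] carries the whole previous
    energy over. *)
Lemma penalty_energy_le (R : realType) n p1 p2 (opt : y_update)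
    (f : 'cV[R]_p1 -> \bar R) (g : 'cV[R]_p2 -> \bar R)
    (A : 'M[R]_(n, p1)) (B : 'M[R]_(n, p2)) c (K : set 'cV[R]_n)
    (mu rho0 gam : R) x xh y yt xs ys :
  (forall u, f u != -oo%E) -> convex_efun f ->
  (forall u, g u != -oo%E) -> convex_efun g -> strongly_convex mu g ->
  B != 0 -> K !=set0 -> closed K ->
  convex_set (K : set (convex_lmodType 'cV[R]_n)) ->
  0 < rho0 -> rho0 <= mu / (2 * opnorm B ^+ 2) -> 0 <= gam ->
  generated_by opt f g A B c K rho0 gam x xh y yt ->
  edom f xs -> edom g ys -> K (residual A B c xs ys) ->
  forall k,
  [/\ edom f (x k.+1), edom g (y k.+1) &
   fine (f (x k.+1)) + fine (g (y k.+1))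
   + rho rho0 k * psi A B c K (x k.+1) (y k.+1)
   + tau R k ^+ 2 * (gam / 2 * enorm (xtilde x k.+1 - xs) ^+ 2
       + rho rho0 k.+1 * opnorm B ^+ 2 / 2 * enorm (yt k.+1 - ys) ^+ 2)
   <= fine (f xs) + fine (g ys)
      + tau R k ^+ 2 * (Rp2 B rho0 gam (x 0%N) xs (y 0%N) ys / 2)].
Proof.
move=> fN fcvx gN gcvx gscvx B0 K0 Kcl Kcvx rho0_gt0 rho0_le gam0 gen fxs gys Ks.
have L_gt0 : 0 < opnorm B ^+ 2 by rewrite exprn_gt0// opnorm_gt0.
have rho_gt0 k : 0 < rho rho0 k.
  by rewrite rhoE mulr_gt0// exprn_gt0// invr_gt0 tau_gt0.
have step k : edom f (x k) -> edom g (y k) -> _ := fun fxk gyk =>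
  penalty_step fN fcvx gN gcvx gscvx B0 K0 Kcl Kcvx (tau_gt0 R k) (tau_le1 R k)
    (rho_gt0 k) gam0 fxk fxs gyk gys Ks
    (xhat_xtilde k (init_xh gen) (step_xh gen)) (erefl (yhat y yt k))
    (step_x gen k) (step_yt gen k) (step_y gen k).
have growth k := rho_growth k rho0_gt0 L_gt0 rho0_le.
pose Fs := fine (f xs) + fine (g ys).
pose E := Rp2 B rho0 gam (x 0%N) xs (y 0%N) ys / 2.
(* The left-hand side at [k] is the energy of the preceding step scaled by
   [1 - tau_k]; in this form it makes sense at 0 too, where no preceding
   penalty parameter exists. *)
have advance k : edom f (x k) -> edom g (y k) ->
  (1 - tau R k) * (fine (f (x k)) + fine (g (y k)))
  + (1 - tau R k) ^+ 2 * (rho rho0 k * psi A B c K (x k) (y k))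
  + tau R k ^+ 2 * (gam / 2 * enorm (xtilde x k - xs) ^+ 2
       + rho rho0 k * opnorm B ^+ 2 / 2 * enorm (yt k - ys) ^+ 2)
  <= (1 - tau R k) * Fs + tau R k ^+ 2 * E ->
  [/\ edom f (x k.+1), edom g (y k.+1) &
   fine (f (x k.+1)) + fine (g (y k.+1))
   + rho rho0 k * psi A B c K (x k.+1) (y k.+1)
   + tau R k ^+ 2 * (gam / 2 * enorm (xtilde x k.+1 - xs) ^+ 2
       + rho rho0 k.+1 * opnorm B ^+ 2 / 2 * enorm (yt k.+1 - ys) ^+ 2)
   <= Fs + tau R k ^+ 2 * E].
  move=> fxk gyk le_k; have [fxS gyS leS] := step k fxk gyk; split=> //.
  have := ler_wpM2r (sqr_ge0 (enorm (yt k.+1 - ys))) (growth k).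
  move: leS le_k; rewrite -/Fs [xtilde x k.+1]/xtilde.
  move: (rho rho0 k.+1) (rho rho0 k) (tau R k) => r1 r0 t.
  move: (fine _) (fine _) (fine _) (fine _) (psi _ _ _ _ _ _) (psi _ _ _ _ _ _).
  move: (enorm _) (enorm _) (enorm _) (enorm _) (opnorm _).
  move=> e1 e2 e3 e4 o f1 f2 f3 f4 p5 p6.
  by lra.
elim=> [|k [fxk gyk IH]]; apply: advance => //.
- exact: (init_x gen).
- exact: (init_y gen).
- rewrite (init_yt gen) /E /Rp2 /= subrr !mul0r expr0n !expr1n !mul1r mul0r !add0r.
  by lra.
rewrite -/Fs -/E in IH.
have t_le1 : 0 <= 1 - tau R k.+1 by rewrite subr_ge0 tau_le1.
have rS : (1 - tau R k.+1) * rho rho0 k.+1 = rho rho0 k.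
  by rewrite mulrC divfK// gt_eqF// subr_gt0; exact: (tauS_lt1 R k).
have psiE z : (1 - tau R k.+1) ^+ 2 * (rho rho0 k.+1 * z)
              = (1 - tau R k.+1) * (rho rho0 k * z).
  by rewrite expr2 -mulrA [X in _ * X]mulrA rS.
have sqrE z : tau R k.+1 ^+ 2 * z = (1 - tau R k.+1) * (tau R k ^+ 2 * z).
  by rewrite tauS_sqr -mulrA.
rewrite psiE !sqrE -!(mulrDr (1 - tau R k.+1)).
exact: ler_wpM2l.
Qed.

(** * From the energy estimate to the rates *)

(** Completing the square. *)
Lemma quadratic_bound (R : realType) (r l d e : R) :
  0 < r -> 0 <= l -> 0 <= d -> r / 2 * d ^+ 2 - l * d <= e ->
  d <= (l + Num.sqrt (l ^+ 2 + 2 * r * e)) / r.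
Proof.
move=> r0 l0 d0 le_e; rewrite ler_pdivlMr// addrC -lerBlDr.
have sq_le : (d * r - l) ^+ 2 <= l ^+ 2 + 2 * r * e.
  have := ler_wpM2l (ltW r0) le_e; lra.
have [|neg] := lerP 0 (d * r - l); last first.
  exact: le_trans (ltW neg) (sqrtr_ge0 _).
move=> pos; rewrite -(ger0_norm pos) -sqrtr_sqr ler_sqrt//.
exact: (le_trans (sqr_ge0 _) sq_le).
Qed.

Lemma tau_sqr_le (R : realType) k : tau R k ^+ 2 <= 4 / (k.+1%:R + 1) ^+ 2.
Proof.
have k_gt0 : 0 < k.+1%:R + 1 :> R by rewrite addr_gt0.
have := ler_wpM2l (ltW (tau_gt0 R k)) (invtau_ge R k).
rewrite divff ?gt_eqF ?tau_gt0// ler_pdivlMr ?exprn_gt0// -exprMn => h.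
have : tau R k * (k.+1%:R + 1) <= 2 by rewrite -natr1; lra.
have := mulr_ge0 (ltW (tau_gt0 R k)) (ltW k_gt0).
by move: (_ * _) => z; nra.
Qed.

Lemma eqO_inv_sqr (R : realType) (u : nat -> R) (C : R) :
  (forall k, (1 <= k)%N -> `|u k| <= C / (k%:R + 1) ^+ 2) ->
  (u : nat -> R^o) =O_\oo (fun k : nat => k%:R ^- 2 : R^o).
Proof.
move=> u_le; apply/eqO_exP.
exists (Num.max C 1); first by rewrite lt_max ltr01 orbT.
near=> k.
have k1 : (1 <= k)%N by near: k; exists 1%N.
have k_gt0 : 0 < k%:R :> R by rewrite ltr0n.
apply: (le_trans (u_le k k1)).
rewrite ger0_norm ?invr_ge0 ?exprn_ge0 ?(ltW k_gt0)//.
apply: ler_pM; rewrite ?invr_ge0 ?exprn_ge0 ?addr_ge0 ?(ltW k_gt0)//.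
- rewrite -(pmulr_lge0 _ (x := (k%:R + 1) ^- 2)).
  exact: le_trans (u_le k k1).
  by rewrite invr_gt0 exprn_gt0// addr_gt0.
- by rewrite le_max lexx.
rewrite lef_pV2 ?posrE ?exprn_gt0 ?addr_gt0//.
by rewrite ler_pXn2r ?nnegrE ?addr_ge0 ?(ltW k_gt0)// lerDl.
Unshelve. all: by end_near. Qed.

Theorem theorem2 (R : realType) (n p1 p2 : nat)
    (f : 'cV[R]_p1 -> \bar R) (g : 'cV[R]_p2 -> \bar R)
    (A : 'M[R]_(n, p1)) (B : 'M[R]_(n, p2)) (c : 'cV[R]_n) (K : set 'cV[R]_n)
    (mu_g rho0 gamma0 : R) (opt : y_update)
    (x xh : nat -> 'cV[R]_p1) (y yt : nat -> 'cV[R]_p2)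
    (xs : 'cV[R]_p1) (ys : 'cV[R]_p2) (lams : 'cV[R]_n) :
  proper_fun f -> closed_fun f -> convex_efun f ->
  proper_fun g -> closed_fun g -> convex_efun g ->
  B != 0 ->
  K !=set0 -> closed K -> convex_set (K : set (convex_lmodType 'cV[R]_n)) ->
  standing_assumption f g A B c K ->
  0 < mu_g -> strongly_convex mu_g g ->
  0 < rho0 -> rho0 <= mu_g / (2 * opnorm B ^+ 2) ->
  0 <= gamma0 ->
  generated_by opt f g A B c K rho0 gamma0 x xh y yt ->
  primal_solutions f g A B c K (xs, ys) ->
  dual_solutions f g A B c K lams ->
  let F := objective f g in
  let Fstar := optval f g A B c K in
  let Rp2 := Rp2 B rho0 gamma0 (x 0%N) xs (y 0%N) ys in
  let Rd := Rd B rho0 gamma0 (x 0%N) xs (y 0%N) ys lams in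
  let infeas k := dist K (A *m x k + B *m y k - c) in
  [/\ forall k : nat, (1 <= k)%N ->
        (`|F (x k, y k) - Fstar|
           <= (2 * Num.max (rho0 * Rp2) (2 * enorm lams * Rd)
               / (rho0 * (k%:R + 1) ^+ 2))%:E)%E
        /\ infeas k <= 4 * Rd / (rho0 * (k%:R + 1) ^+ 2),
      (fun k : nat => fine `|F (x k, y k) - Fstar|%E : R^o) =O_\oo
        (fun k : nat => k%:R ^- 2 : R^o)
    & (fun k : nat => infeas k : R^o) =O_\oo (fun k : nat => k%:R ^- 2 : R^o)].

Proof.
move=> [fN _] _ fcvx [gN _] _ gcvx B0 K0 Kcl Kcvx _ mu0 gscvx rho0_gt0 rho0_le
  gam0 gen [rs [lam' sp]] [x' [y' [r' sp']]] F Fstar Rp2' Rd' infeas.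
have FstarE : Fstar = (fine (f xs) + fine (g ys))%:E :=
  saddle_point_optval fN gN K0 Kcl sp.
(* The multiplier may belong to another saddle point than [(xs, ys)]; all
   saddle points share the same value. *)
have FstarE' : fine (f x') + fine (g y') = fine (f xs) + fine (g ys).
  by apply: EFin_inj; rewrite -FstarE -(saddle_point_optval fN gN K0 Kcl sp').
have [fxs gys Krs _ _] := sp.
have Ks : K (residual A B c xs ys) by rewrite (saddle_point_residual fN gN sp).
have energy := penalty_energy_le fN fcvx gN gcvx gscvx B0 K0 Kcl Kcvx rho0_gt0
  rho0_le gam0 gen fxs gys Ks.
have l_ge0 := enorm_ge0 lams.
have Rp2_ge0 : 0 <= Rp2'.
  by rewrite addr_ge0// mulr_ge0 ?sqr_ge0// mulr_ge0 ?sqr_ge0// ltW.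
have Rd_ge0 : 0 <= Rd' by rewrite addr_ge0 ?sqrtr_ge0.
have bounds k : (1 <= k)%N ->
  [/\ f (x k) \is a fin_num, g (y k) \is a fin_num,
    `|fine (f (x k)) + fine (g (y k)) - (fine (f xs) + fine (g ys))|
      <= 2 * Num.max (rho0 * Rp2') (2 * enorm lams * Rd') / (rho0 * (k%:R + 1) ^+ 2)
    & infeas k <= 4 * Rd' / (rho0 * (k%:R + 1) ^+ 2)].
  case: k => [//|k] _; have [fxk gyk le_k] := energy k.
  have r_gt0 j : 0 < rho rho0 j.
    by rewrite rhoE mulr_gt0// exprn_gt0// invr_gt0 tau_gt0.
  have t2_gt0 : 0 < tau R k ^+ 2 by rewrite exprn_gt0// tau_gt0.
  have N_gt0 : 0 < (k.+1%:R + 1) ^+ 2 :> R by rewrite exprn_gt0// addr_gt0.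
  have d_ge0 : 0 <= infeas k.+1 := dist_ge0 _ K0 Kcl.
  have := saddle_point_lower_bound fN gN K0 Kcl sp' fxk gyk.
  rewrite FstarE' -/(infeas k.+1) => F_ge.
  have F_le : fine (f (x k.+1)) + fine (g (y k.+1))
      + rho rho0 k * (1 / 2 * infeas k.+1 ^+ 2)
      <= fine (f xs) + fine (g ys) + tau R k ^+ 2 * (Rp2' / 2).
    apply: le_trans le_k; rewrite lerDl mulr_ge0 ?(ltW t2_gt0)//.
    rewrite addr_ge0// mulr_ge0 ?sqr_ge0 ?divr_ge0//.
    by rewrite mulr_ge0 ?sqr_ge0 ?(ltW (r_gt0 _)).
  have t2_le := tau_sqr_le R k.
  have d_le : infeas k.+1 <= 4 * Rd' / (rho0 * (k.+1%:R + 1) ^+ 2).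
    have : infeas k.+1 <= Rd' / rho rho0 k.
      (* The radicand of [Rd] does not depend on [k], as
         [rho_k * tau_k ^ 2 = rho_0]. *)
      rewrite /Rd' /Rd -/Rp2' -[X in X * Rp2'](rho_tau rho0 k).
      rewrite (_ : _ * Rp2' = 2 * rho rho0 k * (tau R k ^+ 2 * (Rp2' / 2)));
        last by field.
      by apply: quadratic_bound => //; lra.
    move=> /le_trans; apply.
    rewrite (_ : (rho rho0 k)^-1 = tau R k ^+ 2 / rho0); last first.
      by rewrite -[X in _ / X](rho_tau rho0 k) invfM mulrCA divff ?mulr1// gt_eqF.
    rewrite mulrC mulrAC ler_pdivrMr// (le_trans (ler_wpM2r Rd_ge0 t2_le))//.
    by rewrite le_eqVlt; apply/orP; left; apply/eqP; field; rewrite !gt_eqF.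
  split=> //; first by rewrite -(edom_fineK fN fxk).
    by rewrite -(edom_fineK gN gyk).
  have maxE z : z <= Num.max (rho0 * Rp2') (2 * enorm lams * Rd') ->
      2 * z / (rho0 * (k.+1%:R + 1) ^+ 2) <=
      2 * Num.max (rho0 * Rp2') (2 * enorm lams * Rd')
        / (rho0 * (k.+1%:R + 1) ^+ 2).
    move=> z_le; rewrite ler_pM2r ?invr_gt0 ?mulr_gt0//.
    by rewrite ler_pM2l.
  rewrite ler_norml; apply/andP; split.
    have := maxE (2 * enorm lams * Rd'); rewrite le_max lexx orbT => /(_ isT).
    have := ler_wpM2l l_ge0 d_le.
    rewrite (_ : enorm lams * (4 * Rd' / _) = 2 * (2 * enorm lams * Rd')
      / (rho0 * (k.+1%:R + 1) ^+ 2)); last first.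
      by field; rewrite !gt_eqF.
    by lra.
  have := maxE (rho0 * Rp2'); rewrite le_max lexx => /(_ isT).
  have -> : 2 * (rho0 * Rp2') / (rho0 * (k.+1%:R + 1) ^+ 2)
      = 4 / (k.+1%:R + 1) ^+ 2 * (Rp2' / 2).
    by field; rewrite !gt_eqF.
  have := ler_wpM2r (divr_ge0 Rp2_ge0 (ler0n R 2)) t2_le.
  have := mulr_ge0 (ltW (r_gt0 k)) (sqr_ge0 (infeas k.+1)).
  by lra.
split.
- move=> k /bounds[ffin gfin F_le d_le]; split=> //.
  rewrite FstarE /F /objective /= -(fineK ffin) -(fineK gfin).
  by rewrite -!EFinD lee_fin.
- apply: (@eqO_inv_sqr _ _
    (2 * Num.max (rho0 * Rp2') (2 * enorm lams * Rd') / rho0)).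
  move=> k /bounds[ffin gfin F_le _].
  rewrite FstarE /F /objective /= -(fineK ffin) -(fineK gfin).
  rewrite -!EFinD /= normr_id.
  by rewrite (le_trans F_le)// invfM mulrA.
- apply: (@eqO_inv_sqr _ _ (4 * Rd' / rho0)) => k /bounds[_ _ _ d_le].
  by rewrite ger0_norm ?dist_ge0// (le_trans d_le)// invfM mulrA.
Qed.
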